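(* Let $R$ be a commutative finite chain ring of nilpotency index $e$ and residue field $\mathbb{F}_q$, and let $n$ be a positive integer such that $\gcd(n,q)=1$. Then \[c_n(R,a)=c_n(R,1)=q^{e(n-1)}\prod_{d\mid n,\ d\neq 1}\left(1-q^{-\mathrm{ord}_d(q)}\right)^{\frac{\phi(d)}{\mathrm{ord}_d(q)}}\] for all units $a$ in $R$.
   Context: A commutative finite chain ring (CFCR) is a finite commutative ring $R$ with identity $1\neq 0$ whose ideals are linearly ordered by inclusion. Its unique maximal ideal is principal; for a generator $\gamma$ of it, the nilpotency index of $R$ is the smallest positive integer $e$ with $\gamma^e=0$, and the residue field is $R/\gamma R\cong\mathbb{F}_q$ for a prime power $q$. An $n\times n$ circulant matrix over a commutative ring $S$ is a matrix $\mathrm{cir}(a_1,\dots,a_n)$ with first row $(a_1,a_2,\dots,a_n)$, $a_i\in S$, in which each subsequent row is the right cyclic shift of the previous row. For $a\in S$, $c_n(S,a)$ denotes the number of $n\times n$ circulant matrices over $S$ with determinant $a$. $\phi$ is Euler's totient function and $\mathrm{ord}_d(q)$ is the multiplicative order of $q$ modulo $d$. The product runs over positive divisors $d$ of $n$. *)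

(* Defs.v *)
From HB Require Import structures.
From mathcomp Require Import all_boot all_order all_fingroup all_algebra.
From mathcomp Require Import ring_quotient.

Set Implicit Arguments.
Unset Strict Implicit.
Unset Printing Implicit Defensive.

Import GRing.Theory.
Local Open Scope ring_scope.

Section ChainRings.

Variable R : finComUnitRingType.

(* Unlike [idealr_closed], this admits the improper ideal. *)
Definition is_ideal (I : {set R}) : Prop :=
  [/\ 0 \in I,
      forall x y, x \in I -> y \in I -> x + y \in I &
      forall a x, x \in I -> a * x \in I].

Definition chain_ring : Prop :=
  forall I J : {set R}, is_ideal I -> is_ideal J -> I \subset J \/ J \subset I.

Definition maximal_ideal (I : {set R}) : Prop :=
  [/\ is_ideal I, I != [set: R] &
      forall J : {set R}, is_ideal J -> I \subset J -> J = I \/ J = [set: R]].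

Definition principal (g : R) : {set R} := [set g * x | x : R].

Definition nilpotency_index (g : R) (e : nat) : Prop :=
  [/\ (0 < e)%N, g ^+ e = 0 & forall k, (0 < k)%N -> g ^+ k = 0 -> (e <= k)%N].

(* F is isomorphic to R / gR. The quotient [{ideal_quot I}] needs gR as a
   bundled proper ideal [I : idealr R]. *)
Definition residue_isom (g : R) (F : finFieldType) : Prop :=
  exists (I : idealr R) (f : {rmorphism {ideal_quot I} -> F}),
    I =i principal g /\ bijective f.

End ChainRings.

Definition rcshift (R : Type) (n : nat) (v : 'rV[R]_n) : 'rV[R]_n :=
  \row_j v 0 (ord_pred j).

Definition cir (R : Type) (n : nat) (v : 'rV[R]_n) : 'M[R]_n :=
  \matrix_(i < n) iter i (@rcshift R n) v.

Definition circulant_count (n : nat) (R : finComUnitRingType) (a : R) : nat :=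
  #|[set A in [set cir v | v : 'rV[R]_n] | \det A == a]|.

(* Order of q in the unit group of Z/dZ; only meaningful for 1 < d coprime to q
   (['Z_d] is Z/2Z for d < 2, and the value is 1 when q is not a unit). *)
Definition mulord (d q : nat) : nat :=
  #[insubd (1%g : {unit 'Z_d}) (q%:R : 'Z_d)]%g.

(* Main.v *)
(* Multiplying by the circulant matrix [1 + ((c - 1) / n) J] of determinant [c],
   where J is the all-ones matrix, shows that all units are taken equally often
   as determinants, so the count is the number of invertible circulants divided
   by the number of units of R.  Both numbers are read off the residue field F,
   since an element of R is a unit iff its residue is nonzero, and all residue
   fibres have q^(e-1) elements.

   Over an extension L of F with a primitive n-th root of unity, the circulant
   of v has determinant the product of the Fourier coefficients v^(k), and these
   satisfy v^(qk) = v^(k)^q.  So v is determined by one coefficient for each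
   orbit O of k |-> qk on Z/n, which is a fixed point of x |-> x^(q^#|O|) in L.
   There are at most q^#|O| such points, and comparison with the number q^n of
   vectors shows that there are exactly so many and that every choice occurs.
   Invertible circulants choose nonzero coefficients, hence they number the
   product of the q^#|O| - 1; the orbits of the elements of additive order d
   have size ord_d(q). *)
Require Import Defs.
From HB Require Import structures.
From mathcomp Require Import all_boot all_order all_fingroup all_algebra.
From mathcomp Require Import all_solvable all_field ring_quotient.
From mathcomp Require Import ring.

Set Implicit Arguments.
Unset Strict Implicit.
Unset Printing Implicit Defensive.

Import GRing.Theory Num.Theory.
Local Open Scope ring_scope.

(** * Circulant matrices and their products *)

Lemma ord_pred_subr (n : nat) (j : 'I_n.+1) : ord_pred j = j - inZp 1.
Proof.
apply/val_inj; rewrite /= modnDmr; case: n j => [|n] j; first by rewrite !modn1.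
by rewrite [(1 %% _)%N]modn_small // subn1 addnS.
Qed.

(** Each right shift subtracts 1 in the additive group Z/(n+1), so later index changes are
    translations in that group. *)
Lemma cirE (R : Type) (n : nat) (v : 'rV[R]_n.+1) (i j : 'I_n.+1) :
  cir v i j = v 0 (j - i).
Proof.
rewrite !mxE; have -> : j - i = j - inZp i by rewrite valZpK.
elim: (nat_of_ord i) => [|k IHk] in v j *.
  by rewrite /= (_ : inZp 0 = 0) ?subr0 //; apply/val_inj; rewrite /= mod0n.
rewrite iterSr IHk mxE ord_pred_subr -addrA -opprD; congr (v _ (_ - _)).
by apply/val_inj; rewrite /= modnDm addn1.
Qed.

Lemma cir_inj (R : Type) (n : nat) : (0 < n)%N -> injective (@cir R n).
Proof.
case: n => // n _ u v eq_uv; apply/rowP => j.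
by rewrite -[j]subr0 -!cirE eq_uv.
Qed.

Lemma map_cir (R S : Type) (f : R -> S) (n : nat) (v : 'rV[R]_n) :
  map_mx f (cir v) = cir (map_mx f v).
Proof.
case: n v => [|n] v; apply/matrixP => i j; first by case: i.
by rewrite mxE !cirE mxE.
Qed.

Lemma cir_mul (R : pzSemiRingType) (n : nat) (u v : 'rV[R]_n) :
  cir u *m cir v = cir (u *m cir v).
Proof.
case: n u v => [|n] u v; apply/matrixP => i j; first by case: i.
rewrite cirE !mxE (reindex_inj (addIr i)) /=; apply: eq_bigr => k _.
by rewrite !cirE addrK opprD addrAC addrA.
Qed.

(** Both sides are the determinant of the block matrix with rows (1, v) and (-u, 1), factored in two
    ways with the unipotent [L]. *)
Lemma det_add1_mul (R : comPzRingType) (n m : nat)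
    (u : 'M[R]_(n, m)) (v : 'M[R]_(m, n)) :
  \det (1%:M + u *m v) = \det (1%:M + v *m u).
Proof.
pose L := block_mx 1%:M 0 (- u) 1%:M : 'M[R]_(m + n).
have <- : \det (L *m block_mx 1%:M v 0 (1%:M + u *m v)) = \det (1%:M + u *m v).
  by rewrite det_mulmx det_lblock det_ublock !det1 !mul1r.
have <- : \det (block_mx (1%:M + v *m u) v 0 1%:M *m L) = \det (1%:M + v *m u).
  by rewrite det_mulmx det_lblock det_ublock !det1 !mulr1.
rewrite /L !mulmx_block !(mul1mx, mul0mx, mulmx1, mulmx0, addr0, add0r).
by rewrite mulNmx mulmxN addrK addrC addrK.
Qed.

(** * Circulants with a given unit determinant *)

Lemma circulant_count_card (n : nat) (R : finComUnitRingType) (a : R) :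
  (0 < n)%N -> circulant_count n a = #|[set v : 'rV[R]_n | \det (cir v) == a]|.
Proof.
move=> n_gt0; rewrite /circulant_count -(card_imset _ (@cir_inj R n n_gt0)).
apply: eq_card => A; rewrite !inE.
apply/andP/imsetP => [[/imsetP[v _ ->] det_v] | [v]].
  by exists v; rewrite ?inE.
by rewrite inE => det_v ->; split=> //; apply/imsetP; exists v.
Qed.

Lemma exists_cir_det (R : comUnitRingType) (n : nat) (c : R) :
  (0 < n)%N -> (n%:R : R) \is a GRing.unit ->
  exists v : 'rV[R]_n, \det (cir v) = c.
Proof.
case: n => // n _ n_unit; pose t := (c - 1) / n.+1%:R.
exists (\row_j ((j == 0)%:R + t)).
(* Splitting t J as a column times a row makes the determinant that of a 1 x 1 matrix, 1 + (n+1) t =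
   c. *)
have -> : cir (\row_(j < n.+1) ((j == 0)%:R + t)) =
    1%:M + (const_mx t : 'cV_n.+1) *m (const_mx 1 : 'rV_n.+1).
  apply/matrixP => i j; rewrite cirE !mxE big_ord1 !mxE mulr1 subr_eq0.
  by rewrite eq_sym.
rewrite det_add1_mul det_mx11 !mxE.
rewrite (eq_bigr (fun=> t)) => [|k _]; last by rewrite !mxE mul1r.
by rewrite sumr_const card_ord -[t *+ _]mulr_natr /t divrK // addrC subrK.
Qed.

(** Right multiplication by a circulant of determinant c is injective. Applied to c and then to its
    inverse, the inequality becomes an equality. *)
Lemma circulant_count_le (R : finComUnitRingType) (n : nat) (a c : R) :
  (0 < n)%N -> (n%:R : R) \is a GRing.unit -> c \is a GRing.unit ->
  (circulant_count n a <= circulant_count n (a * c)%R)%N.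
Proof.
move=> n_gt0 n_unit c_unit; rewrite !circulant_count_card //.
have [w det_w] := exists_cir_det c n_gt0 n_unit.
have unit_w : cir w \in unitmx by rewrite unitmxE det_w.
have mul_inj : injective (fun v : 'rV[R]_n => v *m cir w).
  by move=> u v eq_uv; apply: (can_inj (mulmxK unit_w)).
rewrite -(card_imset _ mul_inj); apply/subset_leq_card/subsetP => x /imsetP[v].
by rewrite inE => /eqP det_v ->; rewrite inE -cir_mul det_mulmx det_v det_w.
Qed.

Lemma circulant_count_unit (R : finComUnitRingType) (n : nat) (a : R) :
  (0 < n)%N -> (n%:R : R) \is a GRing.unit -> a \is a GRing.unit ->
  circulant_count n a = circulant_count n (1 : R).
Proof.
move=> n_gt0 n_unit a_unit; apply/eqP; rewrite eqn_leq.
have := circulant_count_le 1 n_gt0 n_unit a_unit; rewrite mul1r => ->.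
have aV_unit : a^-1 \is a GRing.unit by rewrite unitrV.
by have := circulant_count_le a n_gt0 n_unit aV_unit; rewrite divrr // => ->.
Qed.

Lemma circulant_count_mul_units (R : finComUnitRingType) (n : nat) :
  (0 < n)%N -> (n%:R : R) \is a GRing.unit ->
  (#|[set x : R | x \is a GRing.unit]| * circulant_count n (1%R : R))%N =
  #|[set v : 'rV[R]_n | \det (cir v) \is a GRing.unit]|.
Proof.
move=> n_gt0 n_unit; rewrite -sum_nat_const -sum1_card.
rewrite (partition_big (fun v => \det (cir v))
  (mem [set x : R | x \is a GRing.unit])) /=; last by move=> v; rewrite !inE.
apply: eq_bigr => a; rewrite inE => a_unit.
rewrite -(circulant_count_unit n_gt0 n_unit a_unit) circulant_count_card //.
rewrite -sum1_card; apply: eq_bigl => v; rewrite !inE.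
by case: eqP => [->|]; rewrite ?a_unit ?andbF.
Qed.

(** * Reduction from the chain ring to the residue field *)

Lemma card_preimset_additive (V W : finZmodType) (h : {additive V -> W})
    (A : {set W}) :
  (forall y, exists x, h x = y) ->
  #|h @^-1: A| = (#|A| * #|h @^-1: [set 0%R]|)%N.
Proof.
move=> h_surj; rewrite -sum_nat_const -sum1_card.
rewrite (partition_big h (mem A)) /=; last by move=> x; rewrite inE.
apply: eq_bigr => y Ay; have [x0 hx0] := h_surj y.
(* The fibre over y is the kernel translated by [x0]. *)
rewrite -[RHS](card_imset _ (addIr x0)) -sum1_card; apply: eq_bigl => x.
rewrite inE; apply/andP/imsetP => [[_ /eqP hx] | [z]].
  by exists (x - x0); rewrite ?subrK // !inE raddfB hx hx0 subrr.
by rewrite !inE => /eqP hz ->; rewrite raddfD hz hx0 add0r.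
Qed.

(** Trades the quotient for a surjection with kernel gR, the only form in which the residue field is
    used below. *)
Lemma residue_isom_rmorph (R : finComUnitRingType) (g : R) (F : finFieldType) :
  residue_isom g F -> exists f : {rmorphism R -> F},
    (forall y, exists x, f x = y) /\ forall x, (f x == 0) = (x \in principal g).
Proof.
case=> I [h [eqI h_bij]]; pose pi_I := \pi_({ideal_quot I})%qT : R -> {ideal_quot I}.
exists (h \o pi_I : {rmorphism _ -> _}); split=> [y | x] /=.
  case: h_bij => k _ hK; exists (generic_quotient.repr (k y)).
  by rewrite /= /pi_I reprK hK.
rewrite -(rmorph0 h) (inj_eq (bij_inj h_bij)) -eqI.
by rewrite -[x in RHS]subr0 Quotient.idealrBE; congr (_ == _); rewrite piE.
Qed.

Section Residue.

Variables (R : finComUnitRingType) (g : R) (e : nat) (F : finFieldType).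
Variable f : {rmorphism R -> F}.
Hypothesis index_e : nilpotency_index g e.
Hypothesis f_surj : forall y, exists x, f x = y.
Hypothesis f_ker : forall x, (f x == 0) = (x \in principal g).

(** If y lifts the inverse of f x, then 1 - x y lies in gR, hence is nilpotent, and a geometric
    series inverts x y. *)
Lemma unit_residue (x : R) : (x \is a GRing.unit) = (f x != 0).
Proof.
apply/idP/idP => [x_unit | fx_neq0].
  by rewrite -unitfE rmorph_unit.
have [y fy] := f_surj (f x)^-1.
have /imsetP[z _ def_z] : 1 - x * y \in principal g.
  by rewrite -f_ker rmorphB rmorph1 rmorphM fy divff // subrr.
have ge0 : (1 - x * y) ^+ e = 0.
  by case: index_e => _ ge0 _; rewrite def_z exprMn ge0 mul0r.
have: x * y * (\sum_(i < e) (1 - x * y) ^+ i) = 1.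
  apply: oppr_inj; rewrite -mulNr; have := subrX1 (1 - x * y) e.
  by rewrite ge0 sub0r addrAC subrr add0r => <-.
by rewrite -mulrA => xV; apply/unitrP; exists (y * \sum_(i < e) (1 - x * y) ^+ i);
  rewrite mulrC.
Qed.

(** The layer between two successive powers of gR is a copy of F: g^i R is parametrised by pairs (c,
    z), with c in F and z in g^(i+1) R. The section [lift] need not be additive. *)
Lemma card_principal_exp (i : nat) : (i < e)%N ->
  #|principal (g ^+ i)| = (#|F| * #|principal (g ^+ i.+1)|)%N.
Proof.
move=> lt_ie; have [lift liftK] := fin_all_exists f_surj.
pose h (p : F * R) := g ^+ i * lift p.1 + p.2.
have lt_e := index_e; case: lt_e => _ ge0 min_e.
(* If x were a unit and g^i x = g^(i+1) y, then x - g y would be a unit killed by g^i, forcing g^i =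
   0 with i < e. *)
have g_reg (x : R) : g ^+ i * x \in principal (g ^+ i.+1) -> f x = 0.
  case/imsetP=> y _ gx; apply/eqP/contraT; rewrite -unit_residue => x_unit.
  have gy_unit : x - g * y \is a GRing.unit.
    rewrite unit_residue rmorphB (_ : f (g * y) = 0) ?subr0 -?unit_residue //.
    by apply/eqP; rewrite f_ker imset_f.
  have gi0 : g ^+ i = 0.
    apply: (mulIr gy_unit); rewrite mul0r mulrBr gx exprSr -mulrA subrr //.
  (* Minimality of e concerns positive exponents only; for i = 0 the contradiction is 1 = 0. *)
  case: i => [|i] in lt_ie gi0 {gx h} *; first by move/eqP: gi0; rewrite oner_eq0.
  by have := min_e i.+1 isT gi0; rewrite leqNgt lt_ie.
have h_inj : {in setX [set: F] (principal (g ^+ i.+1)) &, injective h}.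
  move=> [c z] [c' z']; rewrite !inE /= /h /= => /imsetP[y _ ->] /imsetP[y' _ ->] eq_h.
  have eq_c : c = c'.
    apply/eqP; rewrite -(liftK c) -(liftK c') -subr_eq0 -rmorphB; apply/eqP/g_reg.
    rewrite mulrBr; apply/imsetP; exists (y' - y) => //.
    apply/eqP; rewrite mulrBr subr_eq addrAC -subr_eq opprK.
    by rewrite eq_h addrC.
  by move: eq_h; rewrite eq_c => /addrI ->.
rewrite -cardsT -cardsX -(card_in_imset h_inj); apply: eq_card => x.
apply/imsetP/imsetP => [[y _ ->] | [[c z]]].
  have: y - lift (f y) \in principal g by rewrite -f_ker rmorphB liftK subrr.
  case/imsetP=> z _ def_z; exists (f y, g ^+ i.+1 * z).
    by rewrite !inE /= imset_f.
  by rewrite /h /= exprSr -mulrA -def_z mulrBr addrC subrK.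
rewrite !inE /= => /imsetP[y _ ->] ->; exists (lift c + g * y) => //.
by rewrite /h /= mulrDr exprSr mulrA.
Qed.

Lemma card_principal : #|principal g| = (#|F| ^ e.-1)%N.
Proof.
have [e_gt0 ge0 _] := index_e.
(* Induction climbs from the zero ideal g^e R, where k = 0, up to gR, where k = e - 1. *)
suffices card_sub k : (k < e)%N -> #|principal (g ^+ (e - k))| = (#|F| ^ k)%N.
  by rewrite -card_sub ?prednK // -subn1 subKn.
elim: k => [_ | k IHk lt_ke].
  rewrite subn0 ge0 expn0; apply/eqP/cards1P; exists 0; apply/setP => x.
  apply/imsetP/set1P => [[y _ ->] | ->]; first by rewrite mul0r.
  by exists 0; rewrite ?mul0r.
rewrite expnS -IHk ?(ltnW lt_ke) // -(subnSK (ltnW lt_ke)) -card_principal_exp //.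
by rewrite ltn_subrL e_gt0.
Qed.

Lemma card_units_residue :
  #|[set x : R | x \is a GRing.unit]| = (#|F|.-1 * #|F| ^ e.-1)%N.
Proof.
have -> : [set x : R | x \is a GRing.unit] = f @^-1: [set~ 0].
  by apply/setP => x; rewrite !inE unit_residue.
rewrite card_preimset_additive // cardsC1 -card_principal; congr (_ * _)%N.
by apply: eq_card => x; rewrite !inE f_ker.
Qed.

Lemma card_residue_ring : #|R| = (#|F| * #|F| ^ e.-1)%N.
Proof.
have [e_gt0 _ _] := index_e.
rewrite -card_principal -{1}[g]expr1 -card_principal_exp // expr0 -cardsT.
by apply: eq_card => x; rewrite inE; apply/esym/imsetP; exists x; rewrite ?mul1r.
Qed.

Lemma card_rV_residue (n : nat) (A : {set 'rV[F]_n}) :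
  #|[set v : 'rV[R]_n | map_mx f v \in A]| = (#|A| * (#|F| ^ e.-1) ^ n)%N.
Proof.
have map_surj (w : 'rV[F]_n) : exists v : 'rV[R]_n, map_mx f v = w.
  have [lift liftK] := fin_all_exists f_surj.
  by exists (map_mx lift w); apply/rowP => i; rewrite !mxE liftK.
have card_map := card_preimset_additive (h := map_mx f : {additive _ -> _}) _ map_surj.
have -> : [set v : 'rV[R]_n | map_mx f v \in A] = map_mx f @^-1: A.
  by apply/setP => v; rewrite !inE.
rewrite card_map; congr (_ * _)%N.
have F_gt0 : (0 < #|F|)%N by apply/card_gt0P; exists 0.
(* The kernel size is read off by counting all vectors: (q q^(e-1))^n is q^n times that size. *)
have := card_map setT; rewrite preimsetT !cardsT !card_mx !mul1n card_residue_ring.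
by rewrite expnMn => /eqP; rewrite eqn_pmul2l ?expn_gt0 ?F_gt0 // => /eqP <-.
Qed.

End Residue.

(** * Orbits of multiplication by q on Z/n *)

Section FunctionOrbits.

Variables (T : finType) (f : T -> T).
Hypothesis f_inj : injective f.

(** Describes orbit lengths by divisibility, ready for comparison with [mulord_dvdn]. *)
Lemma order_dvdn_iter (x : T) (k : nat) : (fingraph.order f x %| k)%N = (iter k f x == x).
Proof.
have iter_ordM m : iter (m * fingraph.order f x) f x = x.
  by elim: m => // m IHm; rewrite mulSn iterD IHm iter_order.
rewrite {2}(divn_eq k (fingraph.order f x)) addnC iterD iter_ordM /dvdn.
apply/eqP/eqP => [-> // | eq_x].
have := findex_iter (ltn_pmod k (fingraph.order_gt0 f x)).
by rewrite eq_x findex0.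
Qed.

Lemma sum_order_froots : (\sum_(x in froots f) fingraph.order f x)%N = #|T|.
Proof.
have sym_f := fconnect_sym f_inj.
rewrite -[RHS]sum1_card [RHS](partition_big (froot f) (mem (froots f))) /=; last first.
  by move=> x _; apply: roots_root.
apply: eq_bigr => x /eqP root_x.
rewrite /fingraph.order -sum1_card; apply: eq_bigl => y.
by rewrite inE -{2}root_x eq_sym root_connect.
Qed.

End FunctionOrbits.

Lemma mulord_dvdn (d q k : nat) : (0 < d)%N -> coprime d q ->
  (mulord d q %| k)%N = (q ^ k == 1 %[mod d]).
Proof.
move=> d_gt0 co_dq; have [d_gt1 | ] := ltnP 1 d; last first.
  (* For d = 1 the type ['Z_1] is Z/2Z, whose unit group is trivial; so [mulord] is 1, in agreement
     with the vacuous congruence modulo 1. *)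
  case: d => [|[|]] // in d_gt0 co_dq *; rewrite !modn1 eqxx.
  have unit1 (u : {unit 'Z_1}) : u = 1%g.
    by apply/val_inj; case: u => [[[|[|]] lt_u] unit_u] //=; apply/val_inj.
  by rewrite /mulord [insubd _ _]unit1 order1 dvd1n.
have q_unit : (q%:R : 'Z_d) \is a GRing.unit by rewrite unitZpE.
rewrite /mulord order_dvdn -val_eqE /= FinRing.val_unitX insubdK //.
by rewrite -natrX -val_eqE /= !val_Zp_nat // (modn_small d_gt1).
Qed.

Lemma mulord_gt0 (d q : nat) : (0 < mulord d q)%N.
Proof. exact: order_gt0. Qed.

(** The quotient n / gcd(n, i) is the additive order of i in Z/n; the elements of order d are j
    (n/d) with j < d prime to d. *)
Lemma card_gcdn_quotient (n d : nat) : (0 < n)%N -> (d %| n)%N ->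
  #|[set i : 'I_n | n %/ gcdn n i == d]%N| = totient d.
Proof.
move=> n_gt0 d_dvd; have d_gt0 := dvdn_gt0 n_gt0 d_dvd.
have nd_gt0 : (0 < n %/ d)%N by rewrite divn_gt0 // dvdn_leq.
have lt_h (j : 'I_d) : (j * (n %/ d) < n)%N.
  by rewrite -[ltnRHS](divnK d_dvd) mulnC ltn_pmul2l.
pose h j := Ordinal (lt_h j).
have h_inj : injective h.
  by move=> j k /(congr1 val) /eqP; rewrite /= eqn_pmul2r // => /eqP /val_inj.
rewrite totient_count_coprime big_mkord -big_mkcond /= sum1_card.
rewrite -(card_imset _ h_inj); apply: eq_card => i; rewrite inE.
have eq_n : n = (d * (n %/ d))%N by rewrite mulnC divnK.
apply/eqP/imsetP => [def_d | [j co_dj ->]].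
  have g_dvd := dvdn_gcdl n i; have gi_dvd := dvdn_gcdr n i.
  have def_g : gcdn n i = (n %/ d)%N.
    by rewrite -def_d divnA // mulKn.
  have lt_j : (i %/ gcdn n i < d)%N.
    by rewrite ltn_divLR ?def_g // -?eq_n // -def_g.
  exists (Ordinal lt_j); last by apply/val_inj; rewrite /= -def_g divnK.
  change (gcdn d (i %/ gcdn n i) == 1)%N.
  rewrite -(eqn_pmul2r (m := gcdn n i)) ?gcdn_gt0 ?n_gt0 //.
  by rewrite muln_gcdl divnK // {1}def_g -eq_n mul1n.
rewrite /= {2}eq_n -muln_gcdl (eqP (co_dj : coprime d j)) mul1n.
by rewrite divnA ?dvdn_div // mulKn.
Qed.

Section MulOrbits.

Variables (n q : nat).
Hypotheses (q_gt0 : (0 < q)%N) (co_nq : coprime n.+1 q).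

Definition mulq (i : 'I_n.+1) : 'I_n.+1 := inZp (q * i).

Lemma iter_mulq (k : nat) (i : 'I_n.+1) : iter k mulq i = inZp (q ^ k * i).
Proof.
elim: k => [|k IHk]; first by rewrite expn0 mul1n valZpK.
by rewrite iterS IHk; apply/val_inj; rewrite /= modnMmr mulnA -expnS.
Qed.

Lemma mulq_inj : injective mulq.
Proof.
move=> i j /(congr1 val) /= /eqP.
wlog le_ij : i j / (i <= j)%N => [th | ].
  case/orP: (leq_total i j) => le_ij eq_ij; first exact: th.
  by apply/esym/th; rewrite // eq_sym.
rewrite eq_sym eqn_mod_dvd ?leq_mul2l ?le_ij ?orbT // -mulnBr Gauss_dvdr //.
rewrite -eqn_mod_dvd // !modn_small // => /eqP eq_ij.
exact/val_inj.
Qed.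

(** With N = n+1 and g = gcd(N, i), q^k i = i modulo N iff N/g divides q^k - 1. So both numbers have
    the same multiples. *)
Lemma order_mulq (i : 'I_n.+1) : fingraph.order mulq i = mulord (n.+1 %/ gcdn n.+1 i) q.
Proof.
set g := gcdn n.+1 i; have g_dvd : (g %| n.+1)%N := dvdn_gcdl n.+1 i.
have g_gt0 : (0 < g)%N by rewrite gcdn_gt0.
have d_gt0 : (0 < n.+1 %/ g)%N by rewrite divn_gt0 // dvdn_leq.
have co_dq : coprime (n.+1 %/ g) q by apply: coprime_dvdl co_nq; apply: dvdn_div.
suffices eq_dvd k : (fingraph.order mulq i %| k)%N = (mulord (n.+1 %/ g) q %| k)%N.
  by apply/eqP; rewrite eqn_dvd eq_dvd dvdnn -eq_dvd dvdnn.
rewrite order_dvdn_iter ?mulord_dvdn //; last exact: mulq_inj.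
rewrite iter_mulq -val_eqE /= -{2}[nat_of_ord i](modn_small (ltn_ord i)).
have qk_gt0 : (0 < q ^ k)%N by rewrite expn_gt0 q_gt0.
rewrite !eqn_mod_dvd ?leq_pmull // -{2}[nat_of_ord i]mul1n -mulnBl.
have gi_dvd : (g %| i)%N := dvdn_gcdr n.+1 i.
transitivity (n.+1 %/ g * g %| (q ^ k - 1) * (i %/ g * g))%N.
  by rewrite !divnK.
rewrite mulnA dvdn_pmul2r // Gauss_dvdl // /coprime -(eqn_pmul2r g_gt0).
by rewrite muln_gcdl !divnK // mul1n.
Qed.

(** The elements of additive order d form a union of orbits of length ord_d(q), hence contain phi(d)
    / ord_d(q) roots. [G] is free because both q^m - 1 and q^m will be multiplied over the
    orbits. *)
Lemma prod_froots_mulq (G : nat -> nat) :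
  (\prod_(i in froots mulq) G (fingraph.order mulq i) =
   \prod_(d <- divisors n.+1) G (mulord d q) ^ (totient d %/ mulord d q))%N.
Proof.
pose cls (i : 'I_n.+1) := (n.+1 %/ gcdn n.+1 i)%N.
transitivity (\prod_(i in froots mulq) \prod_(d <- divisors n.+1 | d == cls i)
   G (mulord d q))%N.
  apply: eq_bigr => i _; rewrite -big_filter filter_pred1_uniq ?divisors_uniq //.
    by rewrite big_seq1 order_mulq.
  by rewrite -dvdn_divisors // dvdn_div // dvdn_gcdl.
rewrite (exchange_big_dep xpredT) //=; apply: eq_big_seq => d.
rewrite -dvdn_divisors // => d_dvd; rewrite prod_nat_const.
pose a := [pred i | cls i == d].
have cls_d i : i \in a -> fingraph.order mulq i = mulord d q.
  by rewrite inE order_mulq => /eqP <-.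
have sub_a : a \subset order_set mulq (mulord d q).
  by apply/subsetP => i /cls_d ord_i; rewrite unfold_in /= ord_i.
(* Multiplication by q preserves gcd(n+1, i), as q is prime to n+1. *)
have closed_a : fclosed mulq a.
  by move=> i _ /eqP <-; rewrite !inE /cls /= gcdn_modr Gauss_gcdr.
have := fcard_order_set mulq_inj sub_a closed_a.
have -> : #|a| = totient d.
  rewrite -(card_gcdn_quotient (isT : 0 < n.+1)%N d_dvd).
  by apply: eq_card => i; rewrite !inE.
move=> <-; rewrite mulnK ?mulord_gt0 //; congr (_ ^ _)%N.
by apply: eq_card => i; rewrite !inE /cls eq_sym.
Qed.

End MulOrbits.

(** * Roots of unity over a finite field *)

Lemma card_pchar_finField (F : finFieldType) (p : nat) : p \in [pchar F] ->
  exists2 m, (0 < m)%N & #|F| = (p ^ m)%N.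
Proof.
move=> pcharF; have card_F := card_pprimeChar pcharF.
exists (logn p #|F|) => //; rewrite lt0n; apply/eqP => log0.
by have := finNzRing_gt1 F; rewrite card_F log0.
Qed.

(** As n is nonzero in F, X^n - 1 is separable; its n distinct roots in a splitting field include a
    primitive one. *)
Lemma exists_prim_root_ext (F : finFieldType) (n : nat) :
  (0 < n)%N -> (n%:R : F) != 0 ->
  exists (L : finFieldType) (f : {rmorphism F -> L}) (w : L),
    n.-primitive_root w.
Proof.
move=> n_gt0 n_neq0; have p_neq0 : 'X^n - 1 != 0 :> {poly F}.
  by rewrite -size_poly_gt0 size_XnsubC.
have [L [rs eq_p _]] := FinSplittingFieldFor p_neq0.
exists (finvect_type L : finFieldType), (in_alg L : {rmorphism F -> L}).
rewrite rmorphB rmorph1 /= map_polyXn in eq_p.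
have nL_neq0 : (n%:R : L) != 0.
  by rewrite -(rmorph_nat (in_alg L)) fmorph_eq0.
have rs_uniq : uniq rs.
  by rewrite -separable_prod_XsubC -(eqp_separable eq_p) separable_Xn_sub_1.
have rs_root : all n.-unity_root rs.
  by apply/allP => z rs_z; rewrite /root_of_unity (eqp_root eq_p) root_prod_XsubC.
have size_rs : (n <= size rs)%N.
  by rewrite -ltnS -(size_prod_XsubC rs id) -(eqp_size eq_p) size_XnsubC.
have [w _ prim_w] := hasP (has_prim_root n_gt0 rs_root rs_uniq size_rs).
by exists w.
Qed.

(** * Fourier diagonalisation of circulants *)

Section Fourier.

Variables (L : fieldType) (n : nat) (w : L).
Hypothesis prim_w : n.+1.-primitive_root w.

Definition fourier_mx : 'M[L]_n.+1 := Vandermonde n.+1 (\row_k w ^+ k).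

Lemma fourier_mxE (u : 'rV[L]_n.+1) (k : 'I_n.+1) :
  (u *m fourier_mx) 0 k = \sum_j u 0 j * w ^+ (k * j).
Proof. by rewrite mxE; apply: eq_bigr => j _; rewrite !mxE exprM. Qed.

Lemma fourier_mx_unit : fourier_mx \in unitmx.
Proof.
rewrite unitmxE unitfE det_Vandermonde; apply/prodf_neq0 => i _.
apply/prodf_neq0 => j lt_ij; rewrite !mxE subr_eq0.
by rewrite (eq_prim_root_expr prim_w) !modn_small // gtn_eqF.
Qed.

(** Translating the summation index by the row i pulls out the factor w^(k i), so column k is an
    eigenvector of every circulant. *)
Lemma cir_mul_fourier (u : 'rV[L]_n.+1) :
  cir u *m fourier_mx = fourier_mx *m diag_mx (u *m fourier_mx).
Proof.
apply/matrixP => i k; rewrite mul_mx_diag [RHS]mxE [LHS]mxE fourier_mxE.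
rewrite (reindex_inj (addIr i)) mulr_sumr; apply: eq_bigr => j _.
rewrite cirE addrK !mxE mulrCA -!exprM -exprD; congr (_ * _).
apply/eqP; rewrite (eq_prim_root_expr prim_w) /=.
by rewrite modnMmr mulnDr addnC.
Qed.

Lemma det_cir (u : 'rV[L]_n.+1) :
  \det (cir u) = \prod_k (u *m fourier_mx) 0 k.
Proof.
have det_neq0 : \det fourier_mx != 0.
  by rewrite -unitfE -unitmxE fourier_mx_unit.
apply: (mulIf det_neq0); rewrite -det_mulmx cir_mul_fourier det_mulmx.
by rewrite det_diag mulrC.
Qed.

End Fourier.

(** * Bounds for the squeeze argument *)

Lemma card_fixed_exp (L : finFieldType) (m : nat) : (1 < m)%N ->
  (#|[pred x : L | x ^+ m == x]| <= m)%N.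
Proof.
move=> m_gt1; pose p := 'X^m - 'X : {poly L}.
have size_p : size p = m.+1.
  by rewrite size_polyDl size_polyXn // size_polyN size_polyX.
rewrite -ltnS -size_p cardE; apply: max_poly_roots (enum_uniq _).
  by rewrite -size_poly_gt0 size_p.
apply/allP => x; rewrite mem_enum inE => /eqP fix_x.
by rewrite /root !hornerE fix_x subrr.
Qed.

(** A strict inequality at one index would make the product of the A i strictly smaller, the other
    factors being positive. *)
Lemma leq_prod_eq (I : finType) (P : pred I) (A B : I -> nat) :
  (forall i, P i -> 0 < A i <= B i)%N ->
  (\prod_(i | P i) B i <= \prod_(i | P i) A i)%N ->
  forall i, P i -> A i = B i.
Proof.
move=> le_AB le_prod i Pi; apply/eqP; rewrite eqn_leq.
have /andP[A_gt0 ->] := le_AB i Pi; rewrite leqNgt; apply: contraL le_prod => lt_AB.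
rewrite -ltnNge !(bigD1 i Pi) /=.
apply: leq_trans (_ : A i * \prod_(j | P j && (j != i)) B j < _)%N.
  by rewrite ltnS leq_mul2l orbC leq_prod // => j /andP[/le_AB /andP[]].
rewrite ltn_pmul2r //; apply: prodn_cond_gt0 => j /andP[/le_AB /andP[Aj_gt0 le_j] _].
exact: leq_trans le_j.
Qed.

Lemma card_ffun_family (I T : finType) (A : I -> pred T) :
  #|(family A : simpl_pred {ffun I -> T})| = (\prod_i #|A i|)%N.
Proof. by rewrite card_family foldrE big_map big_enum. Qed.

(** * Invertible circulants over a finite field *)

Section CirculantField.

Variables (F : finFieldType) (n : nat).
Hypothesis co_nF : coprime n.+1 #|F|.

Local Notation q := #|F|.
Local Notation mulF := (@mulq n q).
Local Notation orb k := (fingraph.order mulF k).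

Variables (L : finFieldType) (f : {rmorphism F -> L}) (w : L).
Hypothesis prim_w : n.+1.-primitive_root w.

Let q_gt1 : (1 < q)%N := finNzRing_gt1 F.
Let q_gt0 : (0 < q)%N := ltnW q_gt1.

Definition spectrum (v : 'rV[F]_n.+1) (k : 'I_n.+1) : L :=
  (map_mx f v *m fourier_mx n w) 0 k.

(** The map x |-> x^q is additive on [L], since q is a power of the characteristic, and it fixes the
    entries coming from F. *)
Lemma spectrum_mulq (v : 'rV[F]_n.+1) (k : 'I_n.+1) :
  spectrum v (mulF k) = spectrum v k ^+ q.
Proof.
have q_nat : [pchar L].-nat q.
  have [p p_pr pcharF] := finPcharP F.
  have [m _ ->] := card_pchar_finField pcharF.
  by rewrite pnatX pnatE // (fmorph_pchar f) pcharF.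
have frobD : {morph (fun x : L => x ^+ q) : x y / x + y}.
  by move=> x y; apply: exprDn_pchar.
rewrite /spectrum !fourier_mxE (big_morph _ frobD (expr0n _ _)) gtn_eqF //=.
apply: eq_bigr => j _; rewrite !mxE exprMn -rmorphXn expf_card -exprM.
congr (_ * _); apply/eqP; rewrite (eq_prim_root_expr prim_w).
by rewrite modnMml -mulnA mulnC.
Qed.

Lemma spectrum_iter_mulq (v : 'rV[F]_n.+1) (m : nat) (k : 'I_n.+1) :
  spectrum v (iter m mulF k) = spectrum v k ^+ (q ^ m).
Proof.
elim: m => [|m IHm]; first by rewrite expr1.
by rewrite iterS spectrum_mulq IHm -exprM -expnSr.
Qed.

Lemma spectrum_froot (v : 'rV[F]_n.+1) (k : 'I_n.+1) :
  spectrum v k = spectrum v (froot mulF k) ^+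
    (q ^ findex mulF (froot mulF k) k).
Proof.
rewrite -spectrum_iter_mulq iter_findex // (fconnect_sym (mulq_inj co_nF)).
exact: connect_root.
Qed.

Lemma det_cir_spectrum (v : 'rV[F]_n.+1) :
  (\det (cir v) != 0) = [forall k in froots mulF, spectrum v k != 0].
Proof.
rewrite -(fmorph_eq0 f) -det_map_mx map_cir (det_cir prim_w).
apply/prodf_neq0/forall_inP => [nz k _ | nz k _]; first exact: nz.
rewrite -/(spectrum v k) spectrum_froot expf_neq0 //.
exact/nz/roots_root/fconnect_sym/(mulq_inj co_nF).
Qed.

(** The value 0 off the roots leaves one free coordinate per orbit. *)
Definition root_spectrum (v : 'rV[F]_n.+1) : {ffun 'I_n.+1 -> L} :=
  [ffun k => if k \in froots mulF then spectrum v k else 0].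

(** By [spectrum_froot] the roots determine the whole spectrum, and the Fourier matrix is
    invertible. *)
Lemma root_spectrum_inj : injective root_spectrum.
Proof.
move=> u v /ffunP eq_uv.
suffices eq_spec k : spectrum u k = spectrum v k.
  apply/rowP => j; apply: (fmorph_inj f).
  have: map_mx f u = map_mx f v.
    by apply: (can_inj (mulmxK (fourier_mx_unit prim_w))); apply/rowP.
  by move/rowP/(_ j); rewrite !mxE.
rewrite (spectrum_froot u) (spectrum_froot v); congr (_ ^+ _).
have root_k : froot mulF k \in froots mulF.
  exact/roots_root/fconnect_sym/(mulq_inj co_nF).
by have := eq_uv (froot mulF k); rewrite !ffunE root_k.
Qed.

(** These are the elements of [L] in the field with q^m elements, m being the orbit length of k. *)
Definition fixed_exp (k : 'I_n.+1) : pred L :=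
  [pred x | x ^+ (q ^ orb k) == x].

Definition root_family (A : 'I_n.+1 -> pred L) (k : 'I_n.+1) : pred L :=
  if k \in froots mulF then A k else pred1 0.

Lemma card_root_family (A : 'I_n.+1 -> pred L) :
  #|(family (root_family A) : simpl_pred {ffun 'I_n.+1 -> L})| =
  (\prod_(k in froots mulF) #|A k|)%N.
Proof.
rewrite card_ffun_family [RHS]big_mkcond; apply: eq_bigr => k _.
by rewrite /root_family; case: ifP => // _; rewrite card1.
Qed.

(** Going once round the orbit returns to k and raises the coefficient to the power q^m. *)
Lemma root_spectrum_family (v : 'rV[F]_n.+1) :
  root_spectrum v \in family (root_family fixed_exp).
Proof.
apply/familyP => k; rewrite ffunE /root_family; case: ifP => _; rewrite inE //=.
by rewrite -spectrum_iter_mulq iter_order //; apply: mulq_inj.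
Qed.

Lemma prod_card_fixed_exp :
  (\prod_(k in froots mulF) q ^ orb k = #|'rV[F]_n.+1|)%N.
Proof.
by rewrite -expn_sum sum_order_froots ?card_ord ?card_mx ?mul1n //; apply: mulq_inj.
Qed.

Lemma card_rV_le_family :
  (#|'rV[F]_n.+1| <= \prod_(k in froots mulF) #|fixed_exp k|)%N.
Proof.
rewrite -card_root_family -(card_codom root_spectrum_inj).
by apply/subset_leq_card/subsetP => _ /codomP[v ->]; apply: root_spectrum_family.
Qed.

Lemma fixed_exp_gt0_le (k : 'I_n.+1) : (0 < #|fixed_exp k| <= q ^ orb k)%N.
Proof.
have qk_gt1 : (1 < q ^ orb k)%N by rewrite -(expn0 q) ltn_exp2l.
rewrite card_fixed_exp // andbT; apply/card_gt0P; exists 0.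
by rewrite inE expr0n gtn_eqF // ltnW.
Qed.

(* [L] need not contain the field with [q ^ orb k] elements a priori: equality is
   forced because [fixed_exp_gt0_le] and [card_rV_le_family] squeeze the product. *)
Lemma card_fixed_exp_order (k : 'I_n.+1) : k \in froots mulF ->
  #|fixed_exp k| = (q ^ orb k)%N.
Proof.
move=> root_k; apply: (leq_prod_eq (P := [in froots mulF])
  (A := fun k => #|fixed_exp k|) (B := fun k => q ^ orb k)%N) => // [i _|].
  exact: fixed_exp_gt0_le.
by rewrite prod_card_fixed_exp card_rV_le_family.
Qed.

(** The image of the injective [root_spectrum] lies in the family and has the same finite
    cardinality. *)
Lemma root_spectrum_surj (h : {ffun 'I_n.+1 -> L}) :
  h \in family (root_family fixed_exp) -> exists v, h = root_spectrum v.
Proof.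
have sub_codom : codom root_spectrum \subset family (root_family fixed_exp).
  by apply/subsetP => _ /codomP[v ->]; apply: root_spectrum_family.
move=> fam_h; apply/codomP; rewrite (subset_cardP _ sub_codom) //.
rewrite (card_codom root_spectrum_inj) card_root_family -prod_card_fixed_exp.
by apply: eq_bigr => k root_k; rewrite card_fixed_exp_order.
Qed.

Lemma card_cir_det_neq0_ext :
  #|[set v : 'rV[F]_n.+1 | \det (cir v) != 0]| =
  (\prod_(d <- divisors n.+1)
     (q ^ mulord d q).-1 ^ (totient d %/ mulord d q))%N.
Proof.
rewrite -(prod_froots_mulq q_gt0 co_nF (fun m => (q ^ m).-1)).
pose fixed_neq0 k := predI (fixed_exp k) (predC1 0).
transitivity (\prod_(k in froots mulF) #|fixed_neq0 k|)%N; last first.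
  apply: eq_bigr => k root_k; rewrite -card_fixed_exp_order // [in RHS](cardD1 0).
  (* 0 is itself a fixed point; removing it accounts for the predecessor. *)
  rewrite inE expr0n gtn_eqF ?expn_gt0 ?q_gt0 ?eqxx //=.
  by apply: eq_card => x; rewrite !inE andbC.
rewrite -card_root_family -(card_imset _ root_spectrum_inj); apply: eq_card => h.
apply/imsetP/familyP => [[v] | fam_h].
  rewrite inE det_cir_spectrum => /forall_inP nz_v -> k.
  have /familyP/(_ k) := root_spectrum_family v; rewrite /root_family !ffunE.
  by case: ifP => // root_k fix_k; apply/andP; split; [exact: fix_k | exact: nz_v].
have /root_spectrum_surj[v def_h] : h \in family (root_family fixed_exp).
  apply/familyP => k; have := fam_h k; rewrite /root_family.
  by case: ifP => // _; rewrite !inE => /andP[].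
exists v; rewrite // inE det_cir_spectrum; apply/forall_inP => k root_k.
by have := fam_h k; rewrite /root_family root_k def_h !inE ffunE root_k => /andP[].
Qed.

End CirculantField.

(** * Closed formula and return to the chain ring *)

Lemma coprime_card_natr_neq0 (F : finFieldType) (n : nat) :
  coprime n #|F| -> (n%:R : F) != 0.
Proof.
move=> co_nq; have [p p_pr pcharF] := finPcharP F.
rewrite -(dvdn_pcharf pcharF) -prime_coprime // coprime_sym.
apply: coprime_dvdr co_nq; have [m m_gt0 ->] := card_pchar_finField pcharF.
by rewrite dvdn_exp.
Qed.

Lemma card_cir_det_neq0 (F : finFieldType) (n : nat) :
  (0 < n)%N -> coprime n #|F| ->
  #|[set v : 'rV[F]_n | \det (cir v) != 0]| =
  (\prod_(d <- divisors n)
     (#|F| ^ mulord d #|F|).-1 ^ (totient d %/ mulord d #|F|))%N.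
Proof.
move=> n_gt0 co_nF.
have [L [f [w]]] := exists_prim_root_ext n_gt0 (coprime_card_natr_neq0 co_nF).
by case: n n_gt0 co_nF => // n _ co_nF; apply: card_cir_det_neq0_ext.
Qed.

Lemma prod_exp_mulord (n q : nat) : (0 < n)%N -> (0 < q)%N -> coprime n q ->
  (\prod_(d <- divisors n) (q ^ mulord d q) ^ (totient d %/ mulord d q) = q ^ n)%N.
Proof.
case: n => // n _ q_gt0 co_nq; rewrite -(prod_froots_mulq q_gt0 co_nq (expn q)).
by rewrite -expn_sum sum_order_froots ?card_ord //; apply: mulq_inj.
Qed.

(** Write q^m - 1 = q^m (1 - q^(-m)). The powers of q multiply to q^n, and with the factor at d = 1
    they give q^(n-1) (q - 1), whose q - 1 will cancel against the number of units. *)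
Lemma prod_predn_exp_mulord (n q : nat) :
  (0 < n)%N -> (0 < q)%N -> coprime n q ->
  (\prod_(d <- divisors n)
     (q ^ mulord d q).-1 ^ (totient d %/ mulord d q))%N%:R =
  q%:R ^+ n.-1 * (q%:R - 1) * \prod_(d <- divisors n | d != 1%N)
    (1 - q%:R ^- mulord d q) ^+ (totient d %/ mulord d q) :> rat.
Proof.
move=> n_gt0 q_gt0 co_nq; pose Q : rat := q%:R.
have Q_neq0 : Q != 0 by rewrite pnatr_eq0 -lt0n.
have eq_exp k m : (((q ^ m).-1 ^ k)%N%:R : rat) =
    ((q ^ m) ^ k)%N%:R * (1 - Q ^- m) ^+ k.
  rewrite !natrX -exprMn mulrBr mulr1 divff ?expf_neq0 //.
  by rewrite -subn1 natrB ?expn_gt0 ?q_gt0 // natrX.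
rewrite natr_prod; under eq_bigr do rewrite eq_exp.
rewrite big_split -natr_prod prod_exp_mulord // natrX.
have mulord1 : mulord 1 q = 1%N.
  by apply/eqP; rewrite -dvdn1 mulord_dvdn ?coprime1n // !modn1.
rewrite [X in _ * X = _](bigD1_seq 1%N) ?divisors_uniq -?dvdn_divisors ?dvd1n //=.
rewrite mulord1 divn1 !mulrA -/Q; congr (_ * _).
by rewrite -[in LHS](prednK n_gt0) exprSr -mulrA mulrBr mulr1 divff.
Qed.

Theorem corollary4p7
  (R : finComUnitRingType) (chainR : chain_ring R)
  (gamma : R) (max_gamma : maximal_ideal (principal gamma))
  (e : nat) (index_e : nilpotency_index gamma e)
  (F : finFieldType) (resF : residue_isom gamma F)
  (q : nat) (card_F : #|F| = q)
  (n : nat) (n_gt0 : (0 < n)%N) (co_nq : coprime n q)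
  (a : R) (unit_a : a \is a GRing.unit) :
  circulant_count n a = circulant_count n (1 : R) /\
  ((circulant_count n (1 : R))%:R : rat) =
    q%:R ^+ (e * (n - 1)) *
    \prod_(d <- divisors n | d != 1%N)
      (1 - q%:R ^- mulord d q) ^+ (totient d %/ mulord d q).
Proof.
have [f [f_surj f_ker]] := residue_isom_rmorph resF.
have unitE := unit_residue index_e f_surj f_ker.
have n_unit : (n%:R : R) \is a GRing.unit.
  by rewrite unitE rmorph_nat coprime_card_natr_neq0 ?card_F.
split; first exact: circulant_count_unit.
have e_gt0 : (0 < e)%N by case: index_e.
have q_gt1 : (1 < q)%N by rewrite -card_F finNzRing_gt1.
have q_gt0 := ltnW q_gt1.
have := circulant_count_mul_units n_gt0 n_unit.
rewrite (card_units_residue index_e f_surj f_ker).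
pose A := [set w : 'rV[F]_n | \det (cir w) != 0].
(* Reduction commutes with [cir] and with determinants, so invertibility is tested over F. *)
have -> : [set v : 'rV[R]_n | \det (cir v) \is a GRing.unit] =
    [set v : 'rV[R]_n | map_mx f v \in A].
  by apply/setP => v; rewrite !inE unitE -det_map_mx map_cir.
rewrite (card_rV_residue index_e f_surj f_ker) card_cir_det_neq0 ?card_F //.
move/(congr1 (fun m => m%:R : rat)); rewrite !natrM prod_predn_exp_mulord //.
pose Q : rat := q%:R; rewrite !natrX -/Q -(subn1 q) natrB // -/Q subn1.
have Q_neq0 : Q != 0 by rewrite pnatr_eq0 -lt0n.
have Q1_neq0 : Q - 1 != 0 by rewrite subr_eq0 (eqr_nat _ q 1) gtn_eqF.
(* Compare after multiplying by the number of units, (q - 1) q^(e-1). The powers of q agree since (n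
   - 1) + (e - 1) n = (e - 1) + e (n - 1). *)
move=> eq_c; apply: (mulfI (mulf_neq0 Q1_neq0 (expf_neq0 e.-1 Q_neq0))).
rewrite eq_c -(prednK e_gt0) -(prednK n_gt0) /= mulSn exprD exprM exprS.
set P := \prod_(_ <- _ | _) _; set S := Q ^+ e.-1.
by rewrite [LHS]mulrC !mulrA; congr (_ * _); rewrite -!mulrA; ring.
Qed.
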